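(* Let $X$ and $Y$ be separable infinite-dimensional Hilbert spaces and let $P\colon X\to Y$ be an injective bounded linear operator. Then $$\inf_{\mathrm{e}} C_{\mathrm{rand}}(\mathrm{e})=C_{\mathrm{det}},$$ where the infimum is taken over all orthonormal bases $\mathrm{e}=\{\mathrm{e}_k\}_{k\in\mathbb{N}}$ of $X$. In particular, if $P^{-1}\colon\operatorname{ran}P\to X$ is unbounded then $\inf_{\mathrm{e}}C_{\mathrm{rand}}(\mathrm{e})=0$.
   Context: $X$ and $Y$ are over the same scalar field ($\mathbb{R}$ or $\mathbb{C}$). The deterministic stability constant is $$C_{\mathrm{det}}=\inf_{x\in X\setminus\{0\}}\frac{\|Px\|_Y^2}{\|x\|_X^2}.$$ Let $(\beta_k^\nu)_{k\in\mathbb{N}}$ be i.i.d. scalar-valued random variables on a probability space $(A,\mathcal{A},\mathbb{P})$ with mean $0$ and variance $1$, so that $\mathbb{E}(|\beta_k^\nu|^2)=1$ for every $k$ ($\nu\in A$ denotes the random event). Given an orthonormal basis $\mathrm{e}=\{\mathrm{e}_k\}_{k\in\mathbb{N}}$ of $X$ and $x=\sum_{k=1}^\infty x_k\mathrm{e}_k\in X$, set $x^\nu=\sum_{k=1}^\infty\beta_k^\nu x_k\mathrm{e}_k$. The randomised stability constant is $$C_{\mathrm{rand}}(\mathrm{e})=\inf_{x\in X\setminus\{0\}}\mathbb{E}\left(\frac{\|P(x^\nu)\|_Y^2}{\|x\|_X^2}\right).$$ *)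

(* Defs.v *)
From HB Require Import structures.
From mathcomp Require Import all_boot all_order all_algebra.
From mathcomp Require Import all_classical all_reals all_analysis.
From mathcomp Require Import sesquilinear complex.

Set Implicit Arguments.
Unset Strict Implicit.
Unset Printing Implicit Defensive.

Import Order.TTheory GRing.Theory Num.Theory.
Import numFieldNormedType.Exports.

Local Open Scope classical_set_scope.
Local Open Scope ring_scope.

Inductive scalar_kind := RealScalars | ComplexScalars.

Definition scalar_field (R : realType) (k : scalar_kind) : numFieldType :=
  match k with
  | RealScalars => R : numFieldType
  | ComplexScalars => R[i] : numFieldType
  end.

Definition scalar_mk (R : realType) (k : scalar_kind) : R -> R -> scalar_field R k :=
  match k with
  | RealScalars => fun x _ => x
  | ComplexScalars => fun x y => Complex x y
  end.

Definition scalar_re (R : realType) (k : scalar_kind) : scalar_field R k -> R :=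
  match k with
  | RealScalars => fun z => z
  | ComplexScalars => fun z => complex.Re z
  end.

Definition scalar_im (R : realType) (k : scalar_kind) : scalar_field R k -> R :=
  match k with
  | RealScalars => fun _ => 0
  | ComplexScalars => fun z => complex.Im z
  end.

Definition scalar_conj (R : realType) (k : scalar_kind) :
    scalar_field R k -> scalar_field R k :=
  match k with
  | RealScalars => fun z => z
  | ComplexScalars => fun z => conjc z
  end.

(* A norm over R[i] takes its (real, nonnegative) values in R[i]; [rnorm] reads
   them in R. *)
Definition rnorm (R : realType) (k : scalar_kind)
    (V : normedZmodType (scalar_field R k)) (v : V) : R := scalar_re `|v|.

(* [inner] is linear in its first argument and conjugate-linear in its
   second. *)
Record hilbert (R : realType) (k : scalar_kind) := Hilbert {
  hilbert_sort :> completeNormedModType (scalar_field R k) ;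
  inner : {dot hilbert_sort for @scalar_conj R k} ;
  innerE : forall x : hilbert_sort, inner x x = `|x| ^+ 2
}.

Definition separable_space (T : topologicalType) :=
  exists2 D : set T, countable D & dense D.

Definition infinite_dimensional (K : fieldType) (V : lmodType K) :=
  ~ exists (n : nat) (v : 'I_n -> V),
      forall x : V, exists c : 'I_n -> K, x = \sum_(i < n) c i *: v i.

Definition bounded_on (R : realType) (k : scalar_kind)
    (V W : normedModType (scalar_field R k)) (D : set V) (f : V -> W) :=
  exists M : R, forall v, D v -> rnorm (f v) <= M * rnorm v.

Definition orthonormal_basis (R : realType) (k : scalar_kind)
    (X : hilbert R k) (e : nat -> X) :=
  (forall i j, inner X (e i) (e j) = (i == j)%:R) /\
  (forall x : X, series (fun n => inner X x (e n) *: e n) @ \oo --> x).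

(* The scalar field with its Borel sigma-algebra. *)
Definition borel_scalar (R : realType) (k : scalar_kind) :=
  g_sigma_algebraType (@open (scalar_field R k)).

HB.instance Definition _ (R : realType) (k : scalar_kind) :=
  Measurable.on (borel_scalar R k).

Section random_scalars.
Context (R : realType) (k : scalar_kind) (d : measure_display).
Context (A : measurableType d) (Pr : probability A R).
Implicit Types f : A -> scalar_field R k.

Definition scalar_integrable f :=
  Pr.-integrable setT (EFin \o (@scalar_re R k \o f)) /\
  Pr.-integrable setT (EFin \o (@scalar_im R k \o f)).

Definition scalar_mean f : scalar_field R k :=
  scalar_mk k (fine 'E_Pr[@scalar_re R k \o f]%E)
            (fine 'E_Pr[@scalar_im R k \o f]%E).

Definition scalar_variance f : \bar R :=
  'E_Pr[fun w => (rnorm (f w - scalar_mean f) ^+ 2)%R]%E.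

Definition mutually_independent (beta : nat -> {RV Pr >-> borel_scalar R k}) :=
  forall (s : seq nat) (B : nat -> set (borel_scalar R k)),
    uniq s -> (forall i, measurable (B i)) ->
    (Pr (\bigcap_(i in [set` s]) (beta i @^-1` B i)) =
     \prod_(i <- s) Pr (beta i @^-1` B i))%E.

Definition identically_distributed
    (beta : nat -> {RV Pr >-> borel_scalar R k}) :=
  forall (i j : nat) (B : set (borel_scalar R k)), measurable B ->
    distribution Pr (beta i) B = distribution Pr (beta j) B.

Definition iid_standardised (beta : nat -> {RV Pr >-> borel_scalar R k}) :=
  [/\ mutually_independent beta, identically_distributed beta &
      forall i, [/\ scalar_integrable (beta i), scalar_mean (beta i) = 0 &
                    scalar_variance (beta i) = 1%E]].

End random_scalars.

Section stability_constants.
Context (R : realType) (k : scalar_kind) (X Y : hilbert R k).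
Context (P : {linear X -> Y}).

Definition C_det : \bar R :=
  ereal_inf [set (rnorm (P x) ^+ 2 / rnorm x ^+ 2)%:E | x in [set x : X | x != 0]].

Context (d : measure_display) (A : measurableType d) (Pr : probability A R).
Context (beta : nat -> {RV Pr >-> borel_scalar R k}).

(* The series converges for almost every [w]; on the exceptional null set
   [limn] is an arbitrary fixed vector, which the expectation below ignores. *)
Definition randomised (e : nat -> X) (x : X) (w : A) : X :=
  limn (series (fun n => ((beta n w : scalar_field R k) * inner X x (e n)) *: e n)).

Definition C_rand (e : nat -> X) : \bar R :=
  ereal_inf [set 'E_Pr[fun w =>
                        (rnorm (P (randomised e x w)) ^+ 2 / rnorm x ^+ 2)%R]%E
            | x in [set x : X | x != 0]].

Definition inf_C_rand : \bar R :=
  ereal_inf [set C_rand e | e in [set e | orthonormal_basis e]].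

End stability_constants.

(* Main.v *)
(** Since [e] is orthonormal, [|x^w|^2 = sum_n |beta_n w|^2 |x_n|^2] for almost
    every [w], and this sum has mean [|x|^2]; integrating the pointwise bound
    [|P (x^w)|^2 >= C_det |x^w|^2] gives [C_rand e >= C_det] for every basis.
    Conversely, normalise a near-minimiser [x] of [C_det] and complete it to a
    basis with [e_0 = x / |x|]: then [x^w = beta_0 w x], so the expectation in
    [C_rand e] at [x] is exactly [|P x|^2 / |x|^2]. *)

Require Import Defs.
From mathcomp Require Import all_boot all_order all_algebra.
From mathcomp Require Import all_classical all_reals all_analysis.
From mathcomp Require Import sesquilinear complex.
From mathcomp Require Import measurable_realfun.

Import Order.TTheory GRing.Theory Num.Theory.
Import numFieldNormedType.Exports.

Local Open Scope classical_set_scope.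
Local Open Scope ring_scope.

Set Implicit Arguments.
Unset Strict Implicit.
Unset Printing Implicit Defensive.

(** * The embedding of the reals in the scalar field *)

Section scalars.
Context (R : realType) (k : scalar_kind).
Local Notation K := (scalar_field R k).

Definition scalar_of_real (r : R) : K := scalar_mk k r 0.

Lemma scalar_of_realK r : scalar_re (scalar_of_real r) = r.
Proof. by rewrite /scalar_of_real; case: k. Qed.

(** In [R[i]] the relation [0 <= z] already forces the imaginary part of [z] to vanish. *)
Lemma scalar_reK (z : K) : 0 <= z -> scalar_of_real (scalar_re z) = z.
Proof.
rewrite /scalar_of_real; move: z; case: k => //= z /ger0_Im.
by case: z => a b /= ->.
Qed.

Lemma scalar_of_real0 : scalar_of_real 0 = 0.
Proof. by rewrite /scalar_of_real; case: k. Qed.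

Lemma scalar_of_real1 : scalar_of_real 1 = 1.
Proof. by rewrite /scalar_of_real; case: k. Qed.

Lemma scalar_of_realM r s :
  scalar_of_real (r * s) = scalar_of_real r * scalar_of_real s.
Proof.
by rewrite /scalar_of_real; case: k => //=; rewrite [RHS]/GRing.mul/= mulr0 mul0r addr0 mulr0 subr0.
Qed.

Lemma scalar_of_realD r s :
  scalar_of_real (r + s) = scalar_of_real r + scalar_of_real s.
Proof.
by rewrite /scalar_of_real; case: k => //=; rewrite [RHS]/GRing.add/= addr0.
Qed.

Lemma ler_scalar_of_real r s :
  (scalar_of_real r <= scalar_of_real s) = (r <= s).
Proof. by rewrite /scalar_of_real; case: k => //=; rewrite lecE/= eqxx. Qed.

Lemma ltr_scalar_of_real r s :
  (scalar_of_real r < scalar_of_real s) = (r < s).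
Proof. by rewrite /scalar_of_real; case: k => //=; rewrite ltcE/= eqxx. Qed.

Lemma scalar_of_real_inj : injective scalar_of_real.
Proof. exact: (can_inj scalar_of_realK). Qed.

Lemma scalar_of_real_ge0 r : (0 <= scalar_of_real r) = (0 <= r).
Proof. by rewrite -scalar_of_real0 ler_scalar_of_real. Qed.

Lemma scalar_of_real_gt0 r : (0 < scalar_of_real r) = (0 < r).
Proof. by rewrite -scalar_of_real0 ltr_scalar_of_real. Qed.

(** [scalar_conj] is defined by cases on [k]; this gives access to the ring morphism lemmas for both
    kinds at once. *)
Lemma scalar_conj_morphism : exists f : {rmorphism K -> K}, @scalar_conj R k =1 f.
Proof.
by case: k; [exists (idfun : {rmorphism R -> R})|exists (conjc : {rmorphism R[i] -> R[i]})].
Qed.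

End scalars.

(** * Real-valued norms and convergence *)

Section rnorm_theory.
Context (R : realType) (k : scalar_kind).
Local Notation K := (scalar_field R k).
Local Notation emb := (@scalar_of_real R k).

Section normedz.
Context (V : normedZmodType K).
Implicit Types u v : V.

Lemma rnormE v : `|v| = emb (rnorm v).
Proof. by rewrite /rnorm scalar_reK. Qed.

Lemma rnorm_ge0 v : 0 <= rnorm v.
Proof. by rewrite -(@scalar_of_real_ge0 R k) -rnormE. Qed.

Lemma rnorm_eq0 v : (rnorm v == 0) = (v == 0).
Proof.
by rewrite -(inj_eq (@scalar_of_real_inj R k)) -rnormE scalar_of_real0 normr_eq0.
Qed.

Lemma rnorm_gt0 v : (0 < rnorm v) = (v != 0).
Proof. by rewrite lt_def rnorm_eq0 rnorm_ge0 andbT. Qed.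

Lemma rnorm0 : rnorm (0 : V) = 0.
Proof. by apply/eqP; rewrite rnorm_eq0. Qed.

Lemma ler_rnormD u v : rnorm (u + v) <= rnorm u + rnorm v.
Proof.
by rewrite -(@ler_scalar_of_real R k) scalar_of_realD -!rnormE ler_normD.
Qed.

Lemma rdistC u v : rnorm (u - v) = rnorm (v - u).
Proof. by rewrite /rnorm distrC. Qed.

Lemma ler_dist_rnorm u v : `|rnorm u - rnorm v| <= rnorm (u - v).
Proof.
rewrite ler_norml; apply/andP; split.
  rewrite lerNl opprB lerBlDr rdistC (le_trans _ (ler_rnormD _ _))//.
  by rewrite subrK.
by rewrite lerBlDr (le_trans _ (ler_rnormD _ _))// subrK.
Qed.

End normedz.

Lemma rnormZ (V : normedModType K) (a : K) (v : V) :
  rnorm (a *: v) = rnorm a * rnorm v.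
Proof.
by apply: (@scalar_of_real_inj R k); rewrite scalar_of_realM -!rnormE normrZ.
Qed.

Lemma rnormM (a b : K) : rnorm (a * b) = rnorm a * rnorm b.
Proof.
by apply: (@scalar_of_real_inj R k); rewrite scalar_of_realM -!rnormE normrM.
Qed.

Lemma rnorm_scalar (r : R) : 0 <= r -> rnorm (emb r) = r.
Proof. by move=> r0; rewrite /rnorm ger0_norm ?scalar_of_real_ge0// scalar_of_realK. Qed.

(** Library convergence uses radii in the scalar field; a positive radius there is the image of a
    positive real, so real radii suffice. *)
Lemma cvg_rnormP (V : normedModType K) (u : nat -> V) (l : V) :
  u @ \oo --> l <->
  forall eps : R, 0 < eps -> exists N, forall n, (N <= n)%N -> rnorm (l - u n) < eps.
Proof.
split=> [/cvgrPdist_lt ul eps eps0|ul].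
  have := ul (emb eps); rewrite scalar_of_real_gt0 => /(_ eps0)[N _ uN].
  by exists N => n /uN /=; rewrite rnormE ltr_scalar_of_real.
apply/cvgrPdist_lt => eps eps0.
have [|N uN] := ul (scalar_re eps).
  by rewrite -(@scalar_of_real_gt0 _ k) scalar_reK ?ltW.
exists N => // n /= /uN; rewrite -(@ltr_scalar_of_real _ k) -rnormE scalar_reK//.
exact: ltW.
Qed.

Lemma cvg_rnorm (V : normedModType K) (u : nat -> V) (l : V) :
  u @ \oo --> l -> (fun n => rnorm (u n)) @ \oo --> rnorm l.
Proof.
move=> /cvg_rnormP ul; apply/cvgrPdist_lt => eps /ul[N uN].
by exists N => // n /= /uN; apply: le_lt_trans; exact: ler_dist_rnorm.
Qed.

End rnorm_theory.

(** * Inner products and orthogonal residuals *)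

Section hilbert_theory.
Context (R : realType) (k : scalar_kind) (X : hilbert R k).
Local Notation K := (scalar_field R k).
Local Notation emb := (@scalar_of_real R k).
Implicit Types (x y u v : X) (a : K) (e : nat -> X).

Lemma scalar_conj0 : scalar_conj (0 : K) = 0.
Proof. by have [f ->] := @scalar_conj_morphism R k; rewrite rmorph0. Qed.

Lemma innerC x y : inner X x y = scalar_conj (inner X y x).
Proof. by rewrite [LHS]hermitian_subproof/= expr0 mul1r. Qed.

Lemma innerDl x y v : inner X (x + y) v = inner X x v + inner X y v.
Proof. exact: linearDl. Qed.

Lemma innerBl x y v : inner X (x - y) v = inner X x v - inner X y v.
Proof. exact: linearBl. Qed.

Lemma innerZl a x v : inner X (a *: x) v = a * inner X x v.
Proof. exact: linearZl_LR. Qed.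

Lemma inner0l v : inner X 0 v = 0.
Proof. exact: linear0l. Qed.

Lemma inner_suml (I : Type) (s : seq I) (p : pred I) (f : I -> X) v :
  inner X (\sum_(i <- s | p i) f i) v = \sum_(i <- s | p i) inner X (f i) v.
Proof. exact: linear_sumlz. Qed.

Lemma inner_eq0C x y : inner X x y = 0 -> inner X y x = 0.
Proof. by move=> xy; rewrite innerC xy scalar_conj0. Qed.

Lemma innerDr v x y : inner X v (x + y) = inner X v x + inner X v y.
Proof. exact: linearDr. Qed.

Lemma innerZr v a x : inner X v (a *: x) = scalar_conj a * inner X v x.
Proof.
rewrite innerC innerZl; have [f fE] := @scalar_conj_morphism R k.
by rewrite fE rmorphM -!fE -innerC.
Qed.

Lemma pythagoras u v : inner X u v = 0 ->
  rnorm (u + v) ^+ 2 = rnorm u ^+ 2 + rnorm v ^+ 2.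
Proof.
move=> uv; apply: (@scalar_of_real_inj R k).
rewrite scalar_of_realD !expr2 !scalar_of_realM -!rnormE -!expr2 -!innerE.
by rewrite innerDl !innerDr uv (inner_eq0C uv) addr0 add0r.
Qed.

Definition orthonormal_seq e := forall i j, inner X (e i) (e j) = (i == j)%:R.

Lemma rnorm_orthonormal e i : inner X (e i) (e i) = 1 -> rnorm (e i) = 1.
Proof.
rewrite innerE => /eqP; rewrite sqrf_eq1 => /orP[|] /eqP ei.
  by rewrite /rnorm ei -scalar_of_real1 scalar_of_realK.
(* The root [-1] is excluded because a norm is nonnegative. *)
by have := normr_ge0 (e i); rewrite ei lerNr oppr0 ler10.
Qed.

Lemma rnorm_sum_orthonormal e (c : nat -> K) m n : orthonormal_seq e ->
  rnorm (\sum_(m <= i < n) c i *: e i) ^+ 2 = \sum_(m <= i < n) rnorm (c i) ^+ 2.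
Proof.
move=> oe; have [nm|mn] := leqP n m; first by rewrite !big_geq// rnorm0 expr0n.
rewrite -(subnKC (ltnW mn)); elim: (n - m)%N => [|p IH].
  by rewrite addn0 !big_geq// rnorm0 expr0n.
rewrite addnS !big_nat_recr ?leq_addr//= pythagoras; last first.
  rewrite inner_suml big_nat big1// => i /andP[_ ip].
  by rewrite innerZl innerZr oe (ltn_eqF ip) !mulr0.
by rewrite IH rnormZ (@rnorm_orthonormal e) ?mulr1// oe eqxx.
Qed.

(** For orthonormal [e], this is [x] minus its orthogonal projection on the span of the first [n]
    vectors. Orthonormality is required only below [n], which is all that is known in the middle of
    the Gram-Schmidt induction. *)
Definition residual e n x := x - \sum_(0 <= i < n) inner X x (e i) *: e i.

Section residual_theory.
Context (e : nat -> X) (n : nat).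
Hypothesis oe : forall i j, (i < n)%N -> (j < n)%N ->
  inner X (e i) (e j) = (i == j)%:R.

Lemma inner_residual x i : (i < n)%N -> inner X (residual e n x) (e i) = 0.
Proof.
move=> ni; rewrite innerBl inner_suml (bigD1_seq i) ?mem_iota ?iota_uniq//=; last first.
  by rewrite subn0.
rewrite innerZl oe// eqxx mulr1 big_seq_cond big1 ?addr0 ?subrr// => j.
rewrite mem_index_iota => /andP[/andP[_ jn] ji].
by rewrite innerZl oe// (negbTE ji) mulr0.
Qed.

(** [x] is the orthogonal sum of its residual and its projection, so Pythagoras applies. *)
Lemma ler_rnorm_residual x : rnorm (residual e n x) <= rnorm x.
Proof.
rewrite -(@ler_pXn2r _ 2%N)// ?nnegrE ?rnorm_ge0//.
rewrite -[in leRHS](subrK (\sum_(0 <= i < n) inner X x (e i) *: e i) x).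
rewrite [leRHS]pythagoras ?lerDl ?sqr_ge0//; apply: inner_eq0C.
rewrite inner_suml big_nat big1// => i /andP[_ ni].
by rewrite innerZl (inner_eq0C (inner_residual x ni)) mulr0.
Qed.

Lemma residualB x y : residual e n (x - y) = residual e n x - residual e n y.
Proof.
rewrite /residual; have -> : \sum_(0 <= i < n) inner X (x - y) (e i) *: e i =
    \sum_(0 <= i < n) inner X x (e i) *: e i - \sum_(0 <= i < n) inner X y (e i) *: e i.
  by rewrite -sumrB; apply: eq_bigr => i _; rewrite innerBl scalerBl.
by rewrite !opprD !opprK addrACA.
Qed.

End residual_theory.

End hilbert_theory.

(** * Gram-Schmidt orthonormalisation of a dense sequence *)

Section gram_schmidt.
Context (R : realType) (k : scalar_kind) (X : hilbert R k).
Local Notation K := (scalar_field R k).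
Local Notation emb := (@scalar_of_real R k).

Definition dense_seq (v : nat -> X) :=
  forall (x : X) (eps : R), 0 < eps -> exists m, rnorm (x - v m) < eps.

(** Index [0] is reserved for [u], and index [m.+1] goes to the point of [D] that an injection into
    the naturals sends to [m]; where there is no such point, [u] is repeated. *)
Lemma separable_dense_seq (u : X) : separable_space X ->
  exists2 v : nat -> X, dense_seq v & v 0%N = u.
Proof.
case=> D /countable_injP[f finj] denseD.
pose v n := if n is m.+1 then xget u [set y | D y /\ f y = m] else u.
exists v => // x eps eps0.
have eps0' : 0 < emb eps by rewrite scalar_of_real_gt0.
have [|y [xy Dy]] := denseD (ball x (emb eps)) _ (ball_open x (emb eps)).
  by exists x; exact: ballxx.
exists (f y).+1; rewrite /v; case: xgetP => [z _ [Dz fzy]|/(_ y)[]//].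
have -> : z = y by apply: finj; rewrite ?inE.
by move: xy; rewrite -ball_normE/= rnormE ltr_scalar_of_real.
Qed.

(** The residual is an additive contraction: vanishing on a dense sequence, it would vanish
    everywhere, and the first [n] vectors of [e] would span [X]. *)
Lemma residual_dense_neq0 (v e : nat -> X) n : infinite_dimensional X ->
  dense_seq v ->
  (forall i j, (i < n)%N -> (j < n)%N -> inner X (e i) (e j) = (i == j)%:R) ->
  exists m, residual e n (v m) != 0.
Proof.
move=> dimX dv oe; apply: contrapT => /forallNP v0; apply: dimX.
exists n, (fun i => e i) => x; exists (fun i => inner X x (e i)).
apply/eqP; rewrite -(big_mkord xpredT (fun i => inner X x (e i) *: e i)).
rewrite -subr_eq0 -/(residual e n x) -rnorm_eq0 eq_le rnorm_ge0 andbT.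
apply/ler_addgt0Pr => eps eps0; rewrite add0r.
have [m /ltW] := dv x _ eps0; apply: le_trans.
rewrite -[leLHS]/(rnorm (residual e n x)).
have /negP := v0 m; rewrite negbK => /eqP vm0.
by rewrite -[residual e n x]subr0 -vm0 -residualB ler_rnorm_residual.
Qed.

Definition normalise (x : X) : X := emb (rnorm x)^-1 *: x.

Lemma rnorm_normalise x : x != 0 -> rnorm (normalise x) = 1.
Proof.
move=> x0; rewrite rnormZ rnorm_scalar ?invr_ge0 ?rnorm_ge0// mulVf//.
by rewrite rnorm_eq0.
Qed.

Lemma normaliseK x : emb (rnorm x) *: normalise x = x.
Proof.
have [->|x0] := eqVneq x 0; first by rewrite /normalise !scaler0.
by rewrite scalerA -scalar_of_realM divff ?rnorm_eq0// scalar_of_real1 scale1r.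
Qed.

Lemma inner_rnorm1 (x : X) : rnorm x = 1 -> inner X x x = 1.
Proof. by rewrite innerE rnormE => ->; rewrite scalar_of_real1 expr1n. Qed.

Variable v : nat -> X.

(** The value [0] of the second branch is a default; for the residuals met in the construction,
    [residual_dense_neq0] puts us in the first branch. *)
Definition first_nonzero (rho : X -> X) : nat :=
  if pselect (exists m, rho (v m) != 0) is left h then ex_minn h else 0%N.

Lemma first_nonzeroP (rho : X -> X) : (exists m, rho (v m) != 0) ->
  rho (v (first_nonzero rho)) != 0 /\
  forall m, (m < first_nonzero rho)%N -> rho (v m) = 0.
Proof.
rewrite /first_nonzero; case: pselect => // h _; case: ex_minnP => m vm min.
by split => // j; apply: contraTeq => /min; rewrite leqNgt.
Qed.

(* Dependent vectors of [v] are skipped, so that no term is zero. *)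
Definition gs_next (rho : X -> X) : X := normalise (rho (v (first_nonzero rho))).

(** The recursion builds the residual maps rather than the vectors, so that stage [n.+1] calls only
    stage [n]; [gs_residualE] recovers the usual formula with all earlier vectors. *)
Fixpoint gs_residual n : X -> X :=
  if n is m.+1 then
    fun x => gs_residual m x -
      inner X x (gs_next (gs_residual m)) *: gs_next (gs_residual m)
  else id.

Definition gram_schmidt n : X := gs_next (gs_residual n).

Lemma gs_residualE n : gs_residual n = residual gram_schmidt n.
Proof.
apply/funext => x; rewrite /residual; elim: n => [|n IH]; first by rewrite big_geq// subr0.
by rewrite big_nat_recr//= opprD addrA -IH.
Qed.

Hypotheses (dimX : infinite_dimensional X) (dv : dense_seq v).

(** Orthonormality below [n] yields, through [residual_dense_neq0], a nonzero residual to normalise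
    at stage [n]; being a residual, it is orthogonal to the earlier vectors. *)
Lemma gram_schmidt_orthonormal_below n i j : (i < n)%N -> (j < n)%N ->
  inner X (gram_schmidt i) (gram_schmidt j) = (i == j)%:R.
Proof.
elim: n i j => // n IH.
have [vn _] := first_nonzeroP (residual_dense_neq0 dimX dv IH).
have on i : (i < n)%N -> inner X (gram_schmidt n) (gram_schmidt i) = 0.
  move=> ni; rewrite {1}/gram_schmidt/gs_next gs_residualE /normalise innerZl.
  by rewrite (inner_residual IH)// mulr0.
move=> i j; rewrite !ltnS leq_eqVlt => /predU1P[->|ni]; rewrite leq_eqVlt => /predU1P[->|nj].
- by rewrite eqxx inner_rnorm1// rnorm_normalise// gs_residualE.
- by rewrite on// gtn_eqF.
- by rewrite inner_eq0C ?on// ltn_eqF.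
- exact: IH.
Qed.

Lemma gram_schmidt_orthonormal : orthonormal_seq gram_schmidt.
Proof.
move=> i j; apply: (@gram_schmidt_orthonormal_below (maxn i j).+1);
by rewrite ltnS ?leq_maxl ?leq_maxr.
Qed.

Lemma inner_gram_schmidt n x :
  inner X x (gram_schmidt n) = inner X (residual gram_schmidt n x) (gram_schmidt n).
Proof.
rewrite innerBl inner_suml big_nat big1 ?subr0// => i /andP[_ ni].
by rewrite innerZl gram_schmidt_orthonormal ltn_eqF// mulr0.
Qed.

Lemma residual_gram_schmidtS n x : residual gram_schmidt n.+1 x =
  residual gram_schmidt n x -
  inner X (residual gram_schmidt n x) (gram_schmidt n) *: gram_schmidt n.
Proof. by rewrite -inner_gram_schmidt -!gs_residualE. Qed.

(** Each stage picks the first vector of [v] not yet in the span, so [v j] is absorbed at stage [j]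
    at the latest. *)
Lemma residual_gram_schmidt_eq0 n j : (j < n)%N ->
  residual gram_schmidt n (v j) = 0.
Proof.
elim: n j => // n IH j; rewrite ltnS => jn; rewrite residual_gram_schmidtS.
have [r0|r0] := eqVneq (residual gram_schmidt n (v j)) 0.
  by rewrite r0 inner0l scale0r subr0.
(* By induction the residuals at indices below [n] vanish already, so a surviving index is [n]
   itself, and it is the one picked at stage [n]. *)
have jn' : j = n by apply/eqP; rewrite eqn_leq jn leqNgt; apply: contra r0 => /IH ->.
have oe := @gram_schmidt_orthonormal_below n.
have [_ vmin] := first_nonzeroP (residual_dense_neq0 dimX dv oe).
have first_n : first_nonzero (residual gram_schmidt n) = j.
  apply/eqP; rewrite eqn_leq; apply/andP; split; rewrite leqNgt.
    by apply: contra r0 => /vmin ->.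
  rewrite jn'; apply/negP => /IH r0'.
  by have [] := first_nonzeroP (residual_dense_neq0 dimX dv oe); rewrite r0' eqxx.
have gsE : gram_schmidt n = normalise (residual gram_schmidt n (v j)).
  by rewrite {1}/gram_schmidt /gs_next gs_residualE first_n.
apply/eqP; rewrite subr_eq0; apply/eqP; rewrite gsE.
set r := residual _ _ _ in r0 *.
(* Subtracting from [r] its component along its own normalisation leaves zero. *)
by rewrite -{1 2}(normaliseK r) innerZl inner_rnorm1 ?rnorm_normalise// mulr1.
Qed.

(** Completeness comes from density: for [n > m] the residual of [x] is that of [x - v m], hence no
    longer than [x - v m]. *)
Lemma gram_schmidt_basis : orthonormal_basis gram_schmidt.
Proof.
split=> [|x]; first exact: gram_schmidt_orthonormal.
apply/cvg_rnormP => eps eps0; have [m xm] := dv x eps0.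
exists m.+1 => n mn.
rewrite /series/= -[_ - _]/(residual gram_schmidt n x).
rewrite (le_lt_trans _ xm)// -[residual _ _ _]subr0.
rewrite -(residual_gram_schmidt_eq0 mn) -residualB.
by apply: ler_rnorm_residual; exact: (@gram_schmidt_orthonormal_below n).
Qed.

(** This keeps a prescribed unit vector at index [0]: it is the first nonzero vector, and
    normalising does not change it. *)
Lemma gram_schmidt0 : rnorm (v 0%N) = 1 -> gram_schmidt 0 = v 0%N.
Proof.
move=> v1; rewrite /gram_schmidt /gs_next /=.
suff -> : first_nonzero id = 0%N.
  by rewrite /normalise v1 invr1 scalar_of_real1 scale1r.
have v0 : v 0%N != 0 by rewrite -rnorm_gt0 v1.
have [_ min] : _ := @first_nonzeroP id (ex_intro _ 0%N v0).
by apply/eqP; rewrite -leqn0 leqNgt; apply: contra v0 => /min ->.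
Qed.

End gram_schmidt.

Lemma orthonormal_basis_extending (R : realType) (k : scalar_kind)
    (X : hilbert R k) (u : X) :
  separable_space X -> infinite_dimensional X -> rnorm u = 1 ->
  exists2 e : nat -> X, orthonormal_basis e & e 0%N = u.
Proof.
move=> sepX dimX u1; have [v dv v0] := separable_dense_seq u sepX.
exists (gram_schmidt v); first exact: gram_schmidt_basis.
by rewrite gram_schmidt0 v0.
Qed.

(** * Comparison of integrals below a possibly nonmeasurable function *)

Section lower_integral.
Local Open Scope ereal_scope.
Context d (T : measurableType d) (R : realType).
Variable mu : {measure set T -> \bar R}.

Import HBNNSimple.

(* Only [f] needs to be measurable: the integral of a nonnegative function is
   a supremum over the simple functions below it. *)
Lemma ge0_ae_le_integral_measurable_l (f g : T -> \bar R) :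
  (forall x, 0 <= f x) -> measurable_fun setT f -> (forall x, 0 <= g x) ->
  {ae mu, forall x, f x <= g x} -> \int[mu]_x f x <= \int[mu]_x g x.
Proof.
move=> f0 mf g0 [N [mN N0 fgN]].
rewrite (ge0_negligible_integral _ _ _ _ N0)// setTD integral_mkcond.
rewrite !ge0_integralTE//; last by move=> x; exact: erestrict_ge0.
apply: le_ereal_sup => _ [h hf <-]; exists h => //= x.
rewrite (le_trans (hf x))// patchE; case: ifPn => //; rewrite inE => Nx.
by apply: contrapT => fgx; apply: Nx; exact: fgN.
Qed.

End lower_integral.

(** * Random orthonormal series and their mean square *)

Section random_series.
Context (R : realType) (k : scalar_kind) (X : hilbert R k).
Context (d : measure_display) (A : measurableType d) (Pr : probability A R).
Context (beta : nat -> {RV Pr >-> borel_scalar R k}).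
Local Notation K := (scalar_field R k).
Local Notation emb := (@scalar_of_real R k).

(** Open upper rays generate the Borel sets of [R], and their preimages under the norm are open
    because the norm is 1-Lipschitz. *)
Lemma measurable_rnorm_comp (f : A -> borel_scalar R k) :
  measurable_fun setT f ->
  measurable_fun setT (fun w => rnorm (f w : K) : R).
Proof.
move=> mf; apply: (measurability _ (RGenOInfty.measurableE R)).
move=> _ [_ [r ->] <-]; rewrite setTI.
pose U := [set z : K | r < rnorm z].
rewrite (_ : _ @^-1` _ = f @^-1` (U : set (borel_scalar R k))); last first.
  by apply/seteqP; split => w /=; rewrite in_itv/= andbT.
rewrite -[X in measurable X]setTI; apply: mf => //.
apply: sub_sigma_algebra; rewrite /U /=.
rewrite openE => z /= rz; apply/nbhs_ballP.
have e0 : 0 < rnorm z - r by rewrite subr_gt0.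
exists (emb (rnorm z - r)); first by rewrite /= scalar_of_real_gt0.
move=> y; rewrite -ball_normE/= rnormE ltr_scalar_of_real => zy.
have := le_lt_trans (ler_dist_rnorm z y) zy.
by move=> /(le_lt_trans (ler_norm _)); rewrite ltrD2l ltrN2.
Qed.

Definition sq_norm_beta n w : R := rnorm (beta n w : K) ^+ 2.

Hypothesis hbeta : iid_standardised beta.

Lemma expectation_sq_norm_beta n : (\int[Pr]_w (sq_norm_beta n w)%:E = 1)%E.
Proof.
have [_ _ /(_ n)[_ mean0]] := hbeta.
rewrite /scalar_variance unlock mean0 => <-.
by apply: eq_integral => w _; rewrite subr0.
Qed.

Lemma measurable_sq_norm_beta n : measurable_fun setT (sq_norm_beta n).
Proof.
apply: measurable_funX; apply: measurable_rnorm_comp.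
exact: measurable_funP.
Qed.

Section orthonormal.
Variable e : nat -> X.
Hypothesis be : orthonormal_basis e.
Implicit Types x : X.

Lemma parseval_identity x :
  series (fun n => rnorm (inner X x (e n)) ^+ 2) @ \oo --> rnorm x ^+ 2.
Proof.
have [oe /(_ x)/cvg_rnorm sx] := be.
rewrite (_ : series _ = (fun n => rnorm (series (fun n => inner X x (e n) *: e n) n) ^+ 2)).
  by rewrite !expr2; apply: cvgM; exact: sx.
by apply/funext => n; rewrite /series/= rnorm_sum_orthonormal.
Qed.

(* Riesz-Fischer *)
Lemma cvg_orthonormal_series (c : nat -> K) :
  cvgn (series (fun n => rnorm (c n) ^+ 2)) ->
  cvgn (series (fun n => c n *: e n)).
Proof.
have [oe _] := be.
move=> /cauchy_cvgP/cauchy_seriesP cc.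
apply/cauchy_cvgP/cauchy_seriesP => eps eps0.
have eps0' : 0 < scalar_re eps by rewrite -(@scalar_of_real_gt0 _ k) scalar_reK ?ltW.
have := cc _ (exprn_gt0 2 eps0'); apply: filterS => -[m n] /=.
rewrite ger0_norm ?sumr_ge0// => [|i _]; last exact: sqr_ge0.
rewrite -(rnorm_sum_orthonormal _ _ _ oe) ltr_pXn2r ?nnegrE ?rnorm_ge0 ?ltW//.
by rewrite rnormE -[X in _ -> _ < X](scalar_reK (ltW eps0)) ltr_scalar_of_real.
Qed.

(** Parseval for arbitrary square-summable coefficients, the limit being supplied by Riesz-Fischer;
    it is meant for the random coefficients [beta n w * inner X x (e n)]. *)
Lemma cvg_sq_rnorm_orthonormal_series (c : nat -> K) :
  cvgn (series (fun n => rnorm (c n) ^+ 2)) ->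
  series (fun n => rnorm (c n) ^+ 2) @ \oo -->
    rnorm (limn (series (fun n => c n *: e n))) ^+ 2.
Proof.
have [oe _] := be => /cvg_orthonormal_series/cvg_rnorm cc.
rewrite (_ : series _ = (fun n => rnorm (series (fun n => c n *: e n) n) ^+ 2)).
  by rewrite !expr2; apply: cvgM; exact: cc.
by apply/funext => n; rewrite /series/= rnorm_sum_orthonormal.
Qed.

(** Stands in for the squared norm of [randomised beta e x w]: a series of nonnegative extended
    reals has a sum at every [w], whether or not the vector series converges, and that sum is
    measurable in [w]. *)
Definition random_sq_norm x w : \bar R :=
  (\sum_(n <oo) (sq_norm_beta n w * rnorm (inner X x (e n)) ^+ 2)%:E)%E.

Lemma nneseries_parseval x :
  (\sum_(n <oo) (rnorm (inner X x (e n)) ^+ 2)%:E = (rnorm x ^+ 2)%:E)%E.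
Proof.
rewrite -(cvg_lim _ (parseval_identity (x := x)))//.
rewrite -EFin_lim; last by apply: cvgP; exact: parseval_identity.
by congr (limn _); apply/funext => n /=; rewrite sumEFin.
Qed.

Let term_ge0 x n w :
  (0 <= (sq_norm_beta n w * rnorm (inner X x (e n)) ^+ 2)%:E)%E.
Proof. by rewrite lee_fin mulr_ge0 ?sqr_ge0. Qed.

Let measurable_term x n : measurable_fun setT
  (fun w => (sq_norm_beta n w * rnorm (inner X x (e n)) ^+ 2)%:E).
Proof.
apply/measurable_EFinP; apply: measurable_funM => //.
exact: measurable_sq_norm_beta.
Qed.

Lemma random_sq_norm_ge0 x w : (0 <= random_sq_norm x w)%E.
Proof. exact: nneseries_ge0. Qed.

Lemma measurable_random_sq_norm x : measurable_fun setT (random_sq_norm x).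
Proof. exact: ge0_emeasurable_sum. Qed.

(** The terms are nonnegative, so sum and integral commute; each [sq_norm_beta n] has mean 1, and
    Parseval sums what remains. *)
Lemma integral_random_sq_norm x :
  (\int[Pr]_w random_sq_norm x w = (rnorm x ^+ 2)%:E)%E.
Proof.
rewrite integral_nneseries// -nneseries_parseval.
apply: eq_eseriesr => n _.
under eq_integral do rewrite mulrC EFinM.
rewrite ge0_integralZl//.
- by rewrite expectation_sq_norm_beta mule1.
- by apply/measurable_EFinP; exact: measurable_sq_norm_beta.
- by move=> w _; rewrite lee_fin sqr_ge0.
- by rewrite lee_fin sqr_ge0.
Qed.

(** A finite integral makes the scalar series finite almost everywhere, and at each such [w]
    Riesz-Fischer makes the vector series converge. *)
Lemma ae_sq_rnorm_randomised x :
  {ae Pr, forall w,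
    random_sq_norm x w = (rnorm (randomised beta e x w) ^+ 2)%:E}.
Proof.
have : Pr.-integrable setT (random_sq_norm x).
  apply/integrableP; split; first exact: measurable_random_sq_norm.
  rewrite (eq_integral (random_sq_norm x)); first by rewrite integral_random_sq_norm ltry.
  by move=> w _; rewrite gee0_abs// random_sq_norm_ge0.
move=> /integrable_ae => /(_ measurableT); apply: filterS => w /(_ I) fin.
pose c n := (beta n w : K) * inner X x (e n).
have cE : (fun n => (sq_norm_beta n w * rnorm (inner X x (e n)) ^+ 2)%R) =
    fun n => rnorm (c n) ^+ 2.
  by apply/funext => n; rewrite rnormM exprMn.
have cvc : cvgn (series (fun n => rnorm (c n) ^+ 2)).
  rewrite -cE; apply: nnseries_is_cvg => [n|]; first by rewrite mulr_ge0 ?sqr_ge0.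
  by rewrite ltey_eq [X in X || _]fin.
rewrite /randomised -(cvg_lim _ (cvg_sq_rnorm_orthonormal_series cvc))//.
rewrite -EFin_lim// -cE.
by congr (limn _); apply/funext => n /=; rewrite sumEFin.
Qed.

End orthonormal.
End random_series.

(** * The two stability constants *)

Section stability_constants_theory.
Context (R : realType) (k : scalar_kind) (X Y : hilbert R k).
Context (P : {linear X -> Y}).
Hypothesis dimX : infinite_dimensional X.
Local Notation K := (scalar_field R k).
Local Notation emb := (@scalar_of_real R k).

Lemma infinite_dimensional_neq0 : exists x : X, x != 0.
Proof.
apply: contrapT => /forallNP X0; apply: dimX; exists 0%N, (fun=> 0) => x.
exists (fun=> 0); rewrite big_ord0; apply/eqP.
by have /negP := X0 x; rewrite negbK.
Qed.

Lemma C_det_ge0 : (0 <= C_det P)%E.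
Proof.
by apply: le_ereal_inf_tmp => _ [x _ <-]; rewrite lee_fin divr_ge0 ?sqr_ge0.
Qed.

(** The infimum runs over a nonempty set of nonnegative reals; hence [fine (C_det P)] loses
    nothing. *)
Lemma C_det_fin_num : C_det P \is a fin_num.
Proof.
have [x x0] := infinite_dimensional_neq0.
rewrite ge0_fin_numE ?C_det_ge0//; apply: (@le_lt_trans _ _ (rnorm (P x) ^+ 2 / rnorm x ^+ 2)%:E).
  by apply: ereal_inf_lbound; exists x.
exact: ltry.
Qed.

Lemma C_det_stability y : fine (C_det P) * rnorm y ^+ 2 <= rnorm (P y) ^+ 2.
Proof.
have [->|y0] := eqVneq y 0; first by rewrite linear0 !rnorm0 expr0n mulr0.
rewrite -ler_pdivlMr ?exprn_gt0 ?rnorm_gt0// -lee_fin fineK ?C_det_fin_num//.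
by apply: ereal_inf_lbound; exists y.
Qed.

(** By contraposition: a positive constant [c] bounds the inverse on the range by [c^(-1/2)]. *)
Lemma C_det_eq0 :
  ~ bounded_on (range P) (pinv setT P) -> C_det P = 0%E.
Proof.
move=> unb; apply/eqP; rewrite eq_le C_det_ge0 andbT leNgt; apply/negP => C0.
apply: unb; set c := fine (C_det P).
have c0 : 0 < c by rewrite -lte_fin fineK ?C_det_fin_num.
exists (Num.sqrt c^-1) => _ [x _ <-].
(* On the range of [P], [pinv setT P] is a right inverse, so stability can be applied to the vector
   [pinv setT P (P x)]. *)
have PK : P (pinv setT P (P x)) = P x by apply: pinvK; rewrite inE; exists x.
rewrite -(@ler_pXn2r _ 2%N)// ?nnegrE ?mulr_ge0 ?sqrtr_ge0 ?rnorm_ge0//.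
rewrite exprMn sqr_sqrtr ?invr_ge0 ?(ltW c0)// -[in leRHS]PK.
by rewrite ler_pdivlMl// C_det_stability.
Qed.

Context (d : measure_display) (A : measurableType d) (Pr : probability A R).
Context (beta : nat -> {RV Pr >-> borel_scalar R k}).
Hypothesis hbeta : iid_standardised beta.

Lemma C_det_le_C_rand (e : nat -> X) :
  orthonormal_basis e -> (C_det P <= C_rand P beta e)%E.
Proof.
move=> be; apply: le_ereal_inf_tmp => _ [x x0 <-]; rewrite unlock.
have n0 : 0 < rnorm x ^+ 2 by rewrite exprn_gt0 ?rnorm_gt0.
set c := fine (C_det P).
have c0 : 0 <= c by rewrite -lee_fin fineK ?C_det_fin_num// C_det_ge0.
(* Since [random_sq_norm] has mean [rnorm x ^+ 2], the constant becomes an integral and the claim a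
   comparison of integrands. *)
have -> : C_det P = (\int[Pr]_w ((c / rnorm x ^+ 2)%:E * random_sq_norm beta e x w))%E.
  rewrite ge0_integralZl//.
  - by rewrite integral_random_sq_norm// -EFinM divfK ?gt_eqF// fineK ?C_det_fin_num.
  - exact: measurable_random_sq_norm.
  - by move=> w _; exact: random_sq_norm_ge0.
  - by rewrite lee_fin divr_ge0 ?sqr_ge0.
(* The right-hand integrand contains a pointwise [limn] whose measurability has not been
   established; only the left one has to be measurable. *)
apply: ge0_ae_le_integral_measurable_l.
- by move=> w; rewrite mule_ge0 ?random_sq_norm_ge0// lee_fin divr_ge0 ?sqr_ge0.
- by apply: measurable_funeM; exact: measurable_random_sq_norm.
- by move=> w; rewrite lee_fin divr_ge0 ?sqr_ge0.
- have := ae_sq_rnorm_randomised hbeta be x; apply: filterS => w ->.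
  rewrite -EFinM lee_fin mulrAC ler_pM2r ?invr_gt0//.
  exact: C_det_stability.
Qed.

Lemma randomised_basis0 (e : nat -> X) : orthonormal_basis e ->
  forall w, randomised beta e (e 0%N) w = (beta 0%N w : K) *: e 0%N.
Proof.
move=> [oe _] w; apply: lim_near_cst; first exact: norm_hausdorff.
(* The partial sum at index [0] is empty; from index [1] on, all partial sums equal the first term,
   since [e 0] is orthogonal to the later vectors. *)
exists 1%N => // -[//|n] _; rewrite /series/= big_nat_recl// big1_seq ?addr0.
  by rewrite oe eqxx mulr1.
by move=> i _; rewrite oe mulr0 scale0r.
Qed.

Lemma C_rand_le (e : nat -> X) : orthonormal_basis e ->
  (C_rand P beta e <= (rnorm (P (e 0%N)) ^+ 2)%:E)%E.
Proof.
move=> be; have e1 : rnorm (e 0%N) = 1 by apply: rnorm_orthonormal; rewrite be.1.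
have e0 : e 0%N != 0 by rewrite -rnorm_gt0 e1.
apply: ereal_inf_lbound; exists (e 0%N) => //; rewrite unlock.
rewrite (eq_integral (fun w =>
    (rnorm (P (e 0%N)) ^+ 2)%:E * (sq_norm_beta beta 0 w)%:E)%E); last first.
  move=> w _; rewrite randomised_basis0// linearZ rnormZ e1 expr1n divr1.
  by rewrite exprMn mulrC EFinM.
rewrite ge0_integralZl//.
- by rewrite expectation_sq_norm_beta// mule1.
- by apply/measurable_EFinP; exact: measurable_sq_norm_beta.
- by move=> w _; rewrite lee_fin sqr_ge0.
- by rewrite lee_fin sqr_ge0.
Qed.

(** Each quotient in [C_det P] is bounded on its own: at [x] it is the squared norm of the image of
    [normalise x], which can be made the first vector of a basis. *)
Lemma inf_C_rand_le_C_det : separable_space X -> (inf_C_rand P beta <= C_det P)%E.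
Proof.
move=> sepX; apply: le_ereal_inf_tmp => _ [x x0 <-].
have [e be ex] := orthonormal_basis_extending sepX dimX (rnorm_normalise x0).
apply: (@le_trans _ _ (C_rand P beta e)); first by apply: ereal_inf_lbound; exists e.
rewrite (le_trans (C_rand_le be))// ex /normalise linearZ rnormZ.
by rewrite rnorm_scalar ?invr_ge0 ?rnorm_ge0// exprMn exprVn mulrC.
Qed.

Lemma inf_C_rand_eq : separable_space X -> inf_C_rand P beta = C_det P.
Proof.
move=> sepX; apply/eqP; rewrite eq_le inf_C_rand_le_C_det//=.
by apply: le_ereal_inf_tmp => _ [e be <-]; exact: C_det_le_C_rand.
Qed.

End stability_constants_theory.

Theorem proposition4 (R : realType) (k : scalar_kind) (X Y : hilbert R k)
    (sepX : separable_space X) (sepY : separable_space Y)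
    (dimX : infinite_dimensional X) (dimY : infinite_dimensional Y)
    (P : {linear X -> Y}) (injP : injective P) (bndP : bounded_on setT P)
    (d : measure_display) (A : measurableType d) (Pr : probability A R)
    (beta : nat -> {RV Pr >-> borel_scalar R k})
    (hbeta : iid_standardised beta) :
  inf_C_rand P beta = C_det P /\
  (~ bounded_on (range P) (pinv setT P) -> inf_C_rand P beta = 0%E).
Proof.
have -> : inf_C_rand P beta = C_det P by exact: inf_C_rand_eq.
by split=> //; exact: C_det_eq0.
Qed.
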